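(* Let $N\ge 1$ and let $A$ be a $(d+1)\times(d+1)$ complex matrix satisfying the $K$-condition. For $0\le j\le d$ let $\Lambda_j$ be the diagonal matrix with $(\Lambda_j)_{ii}=A_{ij}$, and let $X_j=A^{-1}\Lambda_jA$. Let $\Phi=(\bar A)^*$ be the Krawtchouk matrix in degree $N$. Then for each $j$, $0\le j\le d$, $$\Gamma(X_j)^*\,\Phi=\Phi\,\Gamma(\Lambda_j)^*.$$ Moreover, for $1\le j\le d$, $\Gamma(\Lambda_j)^*$ is the diagonal matrix whose diagonal entries are the entries of the row of $\Phi$ with label $j$, i.e. the row indexed by the multi-index $(N-1)e_0+e_j$.
   Context: Matrices have rows and columns indexed by $0,1,\dots,d$; $A^*$ is the Hermitian transpose. A matrix $A$ satisfies the $K$-condition if $A_{i0}=1$ for $0\le i\le d$ and there exist a diagonal matrix $\mathrm p=\mathrm{diag}(p_0,\dots,p_d)$ with all $p_i>0$ and $\sum_i p_i=1$, and a diagonal matrix $D$ with positive diagonal entries, such that $A^*\mathrm pA=D$ (in particular $A$ is invertible). Multi-indices are tuples $n=(n_0,\dots,n_d)$ of nonnegative integers, $|n|=\sum_i n_i$, $x^n=x_0^{n_0}\cdots x_d^{n_d}$; $e_k$ is the multi-index with $1$ in position $k$ and $0$ elsewhere. For an integer $N\ge 0$, the symmetric power $\bar A$ of a matrix $A$ in degree $N$ is the matrix indexed by multi-indices $m,n$ with $|m|=|n|=N$ defined by $(Ax)^m=\sum_{|n|=N}\bar A_{mn}x^n$, where $(Ax)_i=\sum_j A_{ij}x_j$.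 For a $(d+1)\times(d+1)$ matrix $X$, $\Gamma(X)$ (in degree $N$) is the matrix determined by $\overline{e^{tX}}=e^{t\,\Gamma(X)}$ for all real $t$, i.e. $\Gamma(X)=\frac{d}{dt}\big|_{t=0}\overline{e^{tX}}$. *)

(* Defs.v *)
From HB Require Import structures.
From mathcomp Require Import all_boot all_order all_algebra spectral.
From mathcomp Require Import all_classical all_reals all_analysis.
From mathcomp.real_closed Require Import complex.
(* The notations of mpoly clash with those of mathcomp-analysis. *)
From mathcomp.multinomials Require Import -(notations) mpoly.

Set Implicit Arguments.
Unset Strict Implicit.
Unset Printing Implicit Defensive.

Import Order.TTheory GRing.Theory Num.Theory.
Import numFieldNormedType.Exports.
Local Open Scope ring_scope.
Local Open Scope classical_set_scope.
Local Open Scope complex_scope.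
Local Open Scope sesquilinear_scope.

(* R[i] declared as a numClosedFieldType, so that it and its matrices receive
   their normed topology from mathcomp-analysis; A ^t* is the Hermitian
   transpose. *)
Definition Cplx (R : realType) : numClosedFieldType := R[i].

(* In the order of Cplx R, 0 < z means that z is real and positive. *)
Definition Kcondition (R : realType) (d : nat) (A : 'M[Cplx R]_d.+1) : Prop :=
  (forall i, A i ord0 = 1) /\
  exists p D : 'rV[Cplx R]_d.+1,
    [/\ forall i, 0 < p ord0 i,
        \sum_i p ord0 i = 1,
        forall i, 0 < D ord0 i &
        A^t* *m diag_mx p *m A = diag_mx D].

(* Multi-indices (n_0, ..., n_d) with |n| = N; the bound N.+1 only serves to
   make the type finite. *)
Definition mindex (d N : nat) : finType :=
  {m : bmultinom d.+1 N.+1 | mdeg (bmnm m) == N}.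

Definition mindex_val (d N : nat) (m : mindex d N) : multinom d.+1 :=
  bmnm (val m).

Definition mdim (d N : nat) : nat := #|mindex d N|.

(* The polynomial (Ax)^m in the variables x_0, ..., x_d. *)
Definition linpow (R : realType) (d : nat) (A : 'M[Cplx R]_d.+1)
    (m : multinom d.+1) : mpoly d.+1 (Cplx R) :=
  \prod_i (\sum_j A i j *: mpolyX (Cplx R) (mnm1 j)) ^+ m i.

(* Rows and columns are numbered by the enumeration of the multi-indices. *)
Definition sympow (R : realType) (d N : nat) (A : 'M[Cplx R]_d.+1) :
    'M[Cplx R]_(mdim d N) :=
  \matrix_(a, b) mcoeff (mindex_val (enum_val b))
                        (linpow A (mindex_val (enum_val a))).

Lemma mindex_deg (d N : nat) (m : mindex d N) : mdeg (mindex_val m) = N.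
Proof. exact: eqP (valP m). Qed.

Lemma linpow_homog (R : realType) (d : nat) (A : 'M[Cplx R]_d.+1)
    (m : multinom d.+1) : linpow A m \is @ishomog1 d.+1 (Cplx R) (mdeg m) mdeg.
Proof.
rewrite /linpow mdegE.
elim/big_ind2: _ => [|p e q f hp hq|i _]; first exact: dhomog1.
  exact: dhomogM.
rewrite -[X in @ishomog1 _ _ X]mul1n; apply: dhomogMn.
by apply: rpred_sum => j _; apply: rpredZ; rewrite dhomogX; apply/eqP; exact: mdeg1.
Qed.

(* (Ax)^m = sum_n (sympow A)_{mn} x^n *)
Lemma sympowP (R : realType) (d N : nat) (A : 'M[Cplx R]_d.+1)
    (m : mindex d N) :
  linpow A (mindex_val m) =
  \sum_(n : mindex d N)
     sympow N A (enum_rank m) (enum_rank n) *: mpolyX (Cplx R) (mindex_val n).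
Proof.
apply/mpolyP => k; rewrite raddf_sum /=.
have coefE n : mcoeff k (sympow N A (enum_rank m) (enum_rank n)
                          *: mpolyX (Cplx R) (mindex_val n))
    = mcoeff (mindex_val n) (linpow A (mindex_val m)) * (mindex_val n == k)%:R.
  by rewrite mcoeffZ mcoeffX mxE !enum_rankK.
under eq_bigr do rewrite coefE.
have [kN|kN] := eqVneq (mdeg k) N; last first.
  rewrite (dhomog_nemf_coeff (linpow_homog A _)) ?mindex_deg //.
  rewrite big1 // => n _; case: eqP => [nk|_]; last by rewrite mulr0.
  by rewrite -nk mindex_deg eqxx in kN.
have kb : (mdeg k < N.+1)%N by rewrite kN.
pose k' : mindex d N := exist (fun m : bmultinom d.+1 N.+1 => mdeg (bmnm m) == N)
  (BMultinom kb) (introT eqP kN).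
rewrite (bigD1 k') //= eqxx mulr1 big1 ?addr0 // => n nk'.
case: eqP => [nk|_]; last by rewrite mulr0.
by case/eqP: nk'; do 2!apply: val_inj.
Qed.

Definition expmx (R : realType) (n : nat) (X : 'M[Cplx R]_n) : 'M[Cplx R]_n :=
  limn (series (fun k : nat => k`!%:R^-1 *: X ^+ k)).

(* Such a G exists and is unique (it is the derivative at t = 0 of the left-hand
   side), so the default value 0 plays no role. *)
Definition Gamma (R : realType) (d N : nat) (X : 'M[Cplx R]_d.+1) :
    'M[Cplx R]_(mdim d N) :=
  xget 0 [set G | forall t : R,
    sympow N (expmx (t%:C *: X)) = expmx (t%:C *: G)].

Lemma row_label_deg (d N : nat) (hN : (0 < N)%N) (j : 'I_d.+1) :
  mdeg (mnm_add (mnm_muln (mnm1 ord0) N.-1) (mnm1 j)) = N.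
Proof. by rewrite mdegD mdegMn !mdeg1 mul1n addn1 prednK. Qed.

Lemma row_label_bound (d N : nat) (hN : (0 < N)%N) (j : 'I_d.+1) :
  (mdeg (mnm_add (mnm_muln (mnm1 ord0) N.-1) (mnm1 j)) < N.+1)%N.
Proof. by rewrite row_label_deg. Qed.

(* The multi-index (N-1) e_0 + e_j. *)
Definition row_label (d N : nat) (hN : (0 < N)%N) (j : 'I_d.+1) :
    mindex d N :=
  exist (fun m : bmultinom d.+1 N.+1 => mdeg (bmnm m) == N)
    (BMultinom (row_label_bound hN j))
    (introT eqP (row_label_deg hN j)).

(* Main.v *)
Require Import Defs.
From mathcomp Require Import all_boot all_order all_algebra spectral.
From mathcomp Require Import all_classical all_reals.
From mathcomp Require Import all_analysis.
From mathcomp.real_closed Require Import complex.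
From mathcomp.multinomials Require Import -(notations) mpoly.

(** The identities come from two facts about the symmetric power.

    It is multiplicative ([sympowM], because (ABx)^m is (Ay)^m with Bx
    substituted for y), and the matrix exponential commutes with conjugation
    ([expmx_conj]).  Hence Gamma commutes with conjugation: Gamma(A^-1 L A) is
    the conjugate of Gamma(L) by the symmetric power of A
    ([sympow_generator_conj]).  Multiplying by the symmetric power of A on the
    left and taking adjoints gives the first identity.

    On a diagonal matrix diag(r) everything is explicit.  The symmetric power
    of diag(exp(t r_i)) is diagonal with entries
    prod_i exp(t r_i)^(m_i) = exp(t sum_i m_i r_i), so Gamma(diag(r)) is
    diagonal with entries sum_i m_i r_i ([sympow_generator_diag]).  On the other
    hand, since A_i0 = 1, the coefficient of x_0^(N-1) x_j in
    prod_i (x_0 + A_ij x_j + ...)^(m_i) is sum_i m_i A_ij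
    ([sympow_row_label]): this is the second identity.

    Gamma is specified by an equation between exponentials, so the argument
    rests on some analysis: the matrix exponential series converges
    ([cvg_expmx]), the complex exponential is additive ([expCD]), and a matrix X
    is determined by the function exp(tX) of a real t
    ([expmx_generator_inj]), which makes Gamma well defined. *)

Import Order.TTheory GRing.Theory Num.Theory.
Import numFieldNormedType.Exports.
Local Open Scope ring_scope.
Local Open Scope sesquilinear_scope.
Local Open Scope classical_set_scope.
Local Open Scope complex_scope.

Set Implicit Arguments.
Unset Strict Implicit.
Unset Printing Implicit Defensive.

(** * Convergence of complex sequences and matrices *)

Section Convergence.
Variable R : realType.
Local Notation C := (Cplx R).

Lemma normC_real (x : R) : `|x%:C : C| = `|x|%:C.
Proof. by rewrite normc_def /= expr0n /= addr0 sqrtr_sqr. Qed.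

Lemma norm_RRe (z : C) : `|z| = (complex.Re `|z|)%:C.
Proof. by rewrite RRe_real // normr_real. Qed.

Lemma pos_RRe (e : C) : 0 < e -> exists2 r : R, 0 < r & e = r%:C.
Proof.
move=> e0; have er : (complex.Re e)%:C = e by rewrite RRe_real // gtr0_real.
by exists (complex.Re e) => //; rewrite -ltcR er.
Qed.

Lemma cvg_real_complex (u : nat -> R) (l : R) :
  u @ \oo --> l -> (fun n => (u n)%:C : C) @ \oo --> (l%:C : C).
Proof.
move=> /cvgrPdist_lt ul; apply/cvgrPdist_lt => _ /pos_RRe[e e0 ->].
apply: filterS (ul _ e0) => n.
by rewrite -(rmorphB (real_complex R)) normC_real ltcR.
Qed.

Lemma normC_ge_Re (z : C) (r : R) : `|z| <= r%:C -> `|complex.Re z| <= r.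
Proof.
by move=> zr; rewrite -lecR; apply: le_trans zr; exact: normc_ge_Re.
Qed.

(** The comparison test is known for series in a complete normed module over
    the reals; it is transferred to C through real and imaginary parts.  The
    imaginary part enters with a minus sign because Re(iz) = - Im z, so that
    both parts are bounded by the same lemma on real parts. *)
Lemma cvg_series_dominated (c : nat -> C) (v : nat -> R) :
  (forall k, `|c k| <= (v k)%:C) -> cvgn (series v) -> cvgn (series c).
Proof.
have real_case (a : nat -> R) : (forall k, `|a k| <= v k) ->
    cvgn (series v) -> cvgn (series a).
  move=> av vcv; apply: normed_cvg; apply: (series_le_cvg _ _ av vcv) => // k.
  by apply: le_trans (av k).
move=> cv vcv.
have cRe : cvgn (series (fun k => complex.Re (c k))).
  by apply: real_case => // k; apply: normC_ge_Re.
have cIm : cvgn (series (fun k => - complex.Im (c k))).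
  apply: real_case => // k; rewrite -ReiNIm; apply: normC_ge_Re.
  rewrite normrM; have -> : `|'i%C : C| = 1; last by rewrite mulr1.
  by rewrite normc_def /= expr0n expr1n add0r sqrtr1.
apply/cvg_ex; exists
  ((limn (series (fun k => complex.Re (c k))))%:C
   - 'i%C * (limn (series (fun k => - complex.Im (c k))))%:C).
suff -> : series c = (fun n => (series (fun k => complex.Re (c k)) n)%:C : C)
   - (fun n => 'i%C * (series (fun k => - complex.Im (c k)) n)%:C : C).
  apply: cvgB; first exact: cvg_real_complex.
  by apply: cvgM; [exact: cvg_cst|exact: cvg_real_complex].
apply/funext => n; 
transitivity ((\sum_(0 <= k < n) complex.Re (c k))%:C
   - 'i%C * (\sum_(0 <= k < n) - complex.Im (c k))%:C : C); last by [].
rewrite /series /= !(rmorph_sum (real_complex R)) /= mulr_sumr -sumrB.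
apply: eq_bigr => k _; rewrite {1}[c k]complexE.
by rewrite (rmorphN (real_complex R)) mulrN opprK.
Qed.

Lemma limn_norm_le (u : nat -> C) (l : C) (b : C) :
  u @ \oo --> l -> (\forall n \near \oo, `|u n| <= b) -> `|l| <= b.
Proof.
move=> /cvgrPdist_lt ul ub; apply/ler_addgt0Pr => e e0.
near \oo => n; rewrite -(subrK (u n) l) addrC.
apply: le_trans (ler_normD _ _) _; apply: lerD; first by near: n.
by apply: ltW; near: n; exact: ul.
Unshelve. all: by end_near. Qed.

(** Reduces every limit of matrices below to limits of complex sequences. *)
Lemma cvg_mxP m n (u : nat -> 'M[C]_(m, n)) (L : 'M[C]_(m, n)) :
  u @ \oo --> L <-> forall i j, (fun k => u k i j) @ \oo --> L i j.
Proof.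
split=> [uL i j|uL].
  have := @coord_continuous C m n i j L.
  by move/(cvg_comp _ _ uL).
apply/cvgrPdist_le => e e0.
have near_entries : \forall k \near \oo, forall ij : 'I_m * 'I_n,
    `|L ij.1 ij.2 - u k ij.1 ij.2| <= e.
  apply: filter_forall => -[i j] /=.
  by have /cvgrPdist_le/(_ _ e0) := uL i j.
apply: filterS near_entries => k uk; rewrite /Num.norm /= mx_normE.
move/ltW/nonnegP: e0 uk => -[{}e] uk.
rewrite num_le; apply/bigmax_leP; split=> [|ij _]; rewrite -num_le //=.
by rewrite !mxE; exact: uk.
Qed.

End Convergence.

(** * The matrix exponential *)

Section MatrixExponential.
Variables (R : realType) (n : nat).
Local Notation C := (Cplx R).
Implicit Types X Y : 'M[C]_n.

Lemma entry_bound X : exists2 b : R, 0 <= b & forall i j, `|X i j| <= b%:C.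
Proof.
exists (\sum_(p : 'I_n * 'I_n) complex.Re `|X p.1 p.2|).
  by apply: sumr_ge0 => p _; rewrite -ler0c -norm_RRe normr_ge0.
move=> i j; rewrite (rmorph_sum (real_complex R)) (bigD1 (i, j)) //= -norm_RRe.
by rewrite lerDl sumr_ge0 // => p _; rewrite -norm_RRe normr_ge0.
Qed.

Lemma expr_entry_bound X (b : R) : 0 <= b ->
  (forall i j, `|X i j| <= b%:C) ->
  forall k i j, `|(X ^+ k) i j| <= ((n%:R * b) ^+ k)%:C.
Proof.
move=> b0 Xb; elim=> [|k IH] i j.
  rewrite !expr0 mxE; case: eqP => _; first by rewrite normr1.
  by rewrite normr0 ler0c.
rewrite exprS mxE; apply: le_trans (ler_norm_sum _ _ _) _.
apply: (@le_trans _ _ (\sum_(l < n) (b * (n%:R * b) ^+ k)%:C)).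
  apply: ler_sum => l _; rewrite normrM (rmorphM (real_complex R)).
  by apply: ler_pM; rewrite ?normr_ge0.
rewrite sumr_const card_ord exprS -mulrA [X in _ <= X%:C]mulr_natl.
by rewrite (rmorphMn (real_complex R)).
Qed.

(** The exponential series of X is dominated, entry by entry, by the one of
    the real number n b. *)
Lemma exp_term_bound X (b : R) : 0 <= b ->
  (forall i j, `|X i j| <= b%:C) ->
  forall i j k, `|k`!%:R^-1 * (X ^+ k) i j| <= (exp_coeff (n%:R * b) k)%:C.
Proof.
move=> b0 Xb i j k; rewrite normrM /exp_coeff /= mulrC.
rewrite (rmorphM (real_complex R)) normfV normr_nat.
rewrite (fmorphV (real_complex R)) (rmorph_nat (real_complex R)).
by apply: ler_pM; rewrite ?normr_ge0 ?invr_ge0 ?ler0n //; exact: expr_entry_bound.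
Qed.

Lemma cvg_expmx X :
  series (fun k => k`!%:R^-1 *: X ^+ k) @ \oo --> expmx X.
Proof.
have [b b0 Xb] := entry_bound X.
have entry_cvg i j : cvgn (series (fun k => k`!%:R^-1 * (X ^+ k) i j)).
  apply: (@cvg_series_dominated _ _ (exp_coeff (n%:R * b))).
    exact: exp_term_bound.
  exact: is_cvg_series_exp_coeff.
suff : cvgn (series (fun k => k`!%:R^-1 *: X ^+ k)) by [].
apply/cvg_ex.
exists (\matrix_(i, j) limn (series (fun k => k`!%:R^-1 * (X ^+ k) i j))).
apply/cvg_mxP => i j; rewrite mxE.
rewrite (_ : (fun k => _) = series (fun k => k`!%:R^-1 * (X ^+ k) i j)).
  exact: entry_cvg.
apply/funext => N; rewrite /series /= summxE.
by apply: eq_bigr => k _; rewrite mxE.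
Qed.

Lemma cvg_expmx_entry X i j :
  series (fun k => k`!%:R^-1 * (X ^+ k) i j) @ \oo --> expmx X i j.
Proof.
have /cvg_mxP/(_ i j) := @cvg_expmx X.
rewrite (_ : (fun k => _) = series (fun k => k`!%:R^-1 * (X ^+ k) i j)) //.
apply/funext => N; rewrite /series /= summxE.
by apply: eq_bigr => k _; rewrite mxE.
Qed.

(** The scalar version [exprZn] applies to nontrivial rings only, which excludes
    0 x 0 matrices. *)
Lemma expmxZ (a : C) X k : (a *: X) ^+ k = a ^+ k *: X ^+ k.
Proof.
elim: k => [|k IH]; first by rewrite !expr0 scale1r.
by rewrite !exprS IH -[LHS]/(_ *m _) -scalemxAl -scalemxAr scalerA.
Qed.

(** The terms of degree k >= 2 of exp(tX) carry t^k <= t^2, and the remaining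
    factors sum to at most the exponential of n b, where b bounds the entries
    of X. *)
Lemma expmx_taylor1 X : exists2 c : R, 0 <= c &
  forall (t : R) i j, 0 <= t -> t <= 1 ->
    `|expmx (t%:C *: X) i j - (1%:M i j + t%:C * X i j)| <= (t ^+ 2 * c)%:C.
Proof.
have [b b0 Xb] := entry_bound X.
set q := n%:R * b.
have q0 : 0 <= q by rewrite mulr_ge0.
exists (expR q); first exact: expR_ge0.
move=> t i j t0 t1.
pose p : C := 1%:M i j + t%:C * X i j; rewrite -/p.
have /cvgB := @cvg_expmx_entry (t%:C *: X) i j.
move=> /(_ _ _ (cvg_cst p)) /limn_norm_le; apply.
exists 2 => // -[|[|N]] //= _.
rewrite [X in `|X|](_ : _ =
  series (fun k => k`!%:R^-1 * ((t%:C *: X) ^+ k) i j) N.+2 - p) // /series /=.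
rewrite big_nat_recl // big_nat_recl //= !expr0 expr1 fact0 invr1 !mul1r.
have -> : p = (1 : 'M[C]_n) i j + (t%:C *: X) i j by rewrite [X in _ + X]mxE.
rewrite addrA [X in `|X - _|]addrC addrK.
apply: le_trans (ler_norm_sum _ _ _) _.
apply: (@le_trans _ _ (\sum_(0 <= k < N) (t ^+ 2 * exp_coeff q k.+2)%:C)).
  apply: ler_sum => k _; rewrite expmxZ mxE mulrCA normrM.
  rewrite (rmorphM (real_complex R)); apply: ler_pM; rewrite ?normr_ge0 //.
    rewrite normrX normC_real ger0_norm // -(rmorphXn (real_complex R)).
    by rewrite lecR -addn2 exprD ler_piMl ?exprn_ge0 // exprn_ile1.
  exact: exp_term_bound.
rewrite -(rmorph_sum (real_complex R)) lecR -mulr_sumr ler_wpM2l ?exprn_ge0 //.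
apply: (@le_trans _ _ (series (exp_coeff q) N.+2)).
  rewrite /series /= big_nat_recl // big_nat_recl // addrA lerDr addr_ge0 //.
    exact: exp_coeff_ge0.
  exact: exp_coeff_ge0.
apply: nondecreasing_cvgn_le; last exact: is_cvg_series_exp_coeff.
by apply/nondecreasing_series => k _ _; exact: exp_coeff_ge0.
Qed.

(** By the first-order Taylor estimate, t |X_ij - Y_ij| is O(t^2) as t goes to
    0: X is the derivative of exp(tX) at t = 0. *)
Lemma expmx_generator_inj X Y :
  (forall t : R, expmx (t%:C *: X) = expmx (t%:C *: Y)) -> X = Y.
Proof.
move=> eXY; apply/matrixP => i j; apply/eqP; rewrite -subr_eq0 -normr_le0.
have [c c0 Xc] := expmx_taylor1 X; have [c' c'0 Yc] := expmx_taylor1 Y.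
apply/ler_addgt0Pr => _ /pos_RRe[e e0 ->]; rewrite add0r.
(* This t is at most 1 and satisfies t (c + c') <= e. *)
pose t := e / (e + c + c').
have s0 : 0 < e + c + c' by rewrite ltr_wpDr // ltr_wpDr.
have t0 : 0 < t by rewrite divr_gt0.
have t1 : t <= 1 by rewrite ler_pdivrMr // mul1r -addrA lerDl addr_ge0.
have tC0 : 0 < (t%:C : C) by rewrite ltcR.
rewrite -(ler_pM2l tC0) -{1}(gtr0_norm tC0) -normrM mulrBr.
have -> : t%:C * X i j - t%:C * Y i j =
    (expmx (t%:C *: Y) i j - (1%:M i j + t%:C * Y i j))
    - (expmx (t%:C *: X) i j - (1%:M i j + t%:C * X i j)).
  by rewrite eXY opprB [RHS]addrC addrA subrK opprD addrACA subrr add0r.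
apply: le_trans (ler_normB _ _) _.
apply: le_trans (lerD (Yc _ _ _ (ltW t0) t1) (Xc _ _ _ (ltW t0) t1)) _.
rewrite -(rmorphD (real_complex R)) -(rmorphM (real_complex R)) lecR.
rewrite -mulrDr expr2 -mulrA ler_pM2l // /t mulrAC ler_pdivrMr // ler_pM2l //.
by rewrite addrC -addrA lerDr ltW.
Qed.

Lemma expmx_conj (U V : 'M[C]_n) X : V *m U = 1%:M -> U *m V = 1%:M ->
  expmx (V *m X *m U) = V *m expmx X *m U.
Proof.
move=> VU UV; apply/matrixP => i j.
apply: (cvg_unique _ (@cvg_expmx_entry _ i j)) => //.
have conjX k : (V *m X *m U) ^+ k = V *m X ^+ k *m U.
  elim: k => [|k IH]; first by rewrite !expr0 mulmx1 VU.
  rewrite !exprS IH -[LHS]/(V *m X *m U *m (V *m X ^+ k *m U)) !mulmxA.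
  by rewrite -(mulmxA (V *m X) U V) UV mulmx1 -(mulmxA V X).
have -> : series (fun k => k`!%:R^-1 * ((V *m X *m U) ^+ k) i j) =
  (fun N => \sum_k (\sum_l V i l * series (fun p => p`!%:R^-1 * (X ^+ p) l k) N) * U k j).
  apply/funext => N; rewrite /series /=.
  under eq_bigr do rewrite conjX mxE mulr_sumr.
  rewrite exchange_big /=; apply: eq_bigr => k _.
  under eq_bigr do rewrite mxE mulrA mulr_sumr.
  rewrite -mulr_suml exchange_big /=; congr (_ * _); apply: eq_bigr => l _.
  by rewrite mulr_sumr; apply: eq_bigr => p _; rewrite mulrCA.
rewrite mxE; apply: cvg_big => [|k _]; first exact: add_continuous.
apply: cvgM; last exact: cvg_cst.
rewrite mxE; apply: cvg_big => [|l _]; first exact: add_continuous.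
by apply: cvgM; [exact: cvg_cst|exact: cvg_expmx_entry].
Qed.

End MatrixExponential.

(** * Cauchy products of truncated exponentials *)

Section TruncatedExponential.
Variable K : numFieldType.

(** Writing the truncated exponential of a as the value at 1 of this polynomial
    in an auxiliary variable turns Cauchy products into products of
    polynomials. *)
Definition exp_poly (n : nat) (a : K) : {poly K} :=
  \poly_(k < n) (k`!%:R^-1 * a ^+ k).

Lemma exp_polyM_coef n (a b : K) k : (k < n)%N ->
  (exp_poly n a * exp_poly n b)`_k = k`!%:R^-1 * (a + b) ^+ k.
Proof.
move=> kn; rewrite coefMr exprDn mulr_sumr; apply: eq_bigr => i _.
have ik : (i <= k)%N by rewrite -ltnS.
rewrite !coef_poly (leq_ltn_trans (leq_subr _ _) kn) (leq_ltn_trans ik kn).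
rewrite mulrACA -(mulr_natr (_ * _)) [LHS]mulrC [RHS]mulrCA; congr (_ * _).
rewrite -(bin_fact ik) !natrM !invfM mulrAC mulVf; first by rewrite mul1r mulrC.
by rewrite pnatr_eq0 -lt0n bin_gt0.
Qed.

(** Below degree n, the Cauchy product of the truncated exponentials of a and b
    agrees with the exponential of a + b, by the binomial formula; only the
    degrees from n to 2n - 1 are left. *)
Lemma exp_polyM_sum n (a b : K) :
  (\sum_(0 <= k < n) k`!%:R^-1 * a ^+ k) * (\sum_(0 <= k < n) k`!%:R^-1 * b ^+ k)
  - \sum_(0 <= k < n) k`!%:R^-1 * (a + b) ^+ k
  = \sum_(n <= k < n + n) (exp_poly n a * exp_poly n b)`_k.
Proof.
have trunc_horner c : \sum_(0 <= k < n) k`!%:R^-1 * c ^+ k = (exp_poly n c).[1].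
  rewrite big_mkord (horner_coef_wide 1 (size_poly _ _)).
  by apply: eq_bigr => k _; rewrite coef_poly ltn_ord expr1n mulr1.
rewrite 2!trunc_horner -hornerM (@horner_coef_wide _ (n + n)); last first.
  apply: leq_trans (size_polyMleq _ _) _; apply: leq_trans (leq_pred _) _.
  by apply: leq_add; exact: size_poly.
rewrite -(big_mkord xpredT (fun i => (exp_poly n a * exp_poly n b)`_i * 1 ^+ i)).
under eq_bigr do rewrite expr1n mulr1.
rewrite (big_cat_nat (leq0n n) (leq_addr n n)) /=.
have -> : \sum_(0 <= k < n) k`!%:R^-1 * (a + b) ^+ k =
    \sum_(0 <= k < n) (exp_poly n a * exp_poly n b)`_k.
  by apply: eq_big_nat => k /andP[_ kn]; rewrite exp_polyM_coef.
by rewrite addrAC subrr add0r.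
Qed.

(** The error is a polynomial in a and b with nonnegative coefficients, so it
    is dominated by its value at `|a| and `|b|. *)
Lemma exp_series_mul_error n (a b : K) :
  `|(\sum_(0 <= k < n) k`!%:R^-1 * a ^+ k) * (\sum_(0 <= k < n) k`!%:R^-1 * b ^+ k)
    - \sum_(0 <= k < n) k`!%:R^-1 * (a + b) ^+ k|
  <= (\sum_(0 <= k < n) k`!%:R^-1 * `|a| ^+ k)
       * (\sum_(0 <= k < n) k`!%:R^-1 * `|b| ^+ k)
    - \sum_(0 <= k < n) k`!%:R^-1 * (`|a| + `|b|) ^+ k.
Proof.
rewrite !exp_polyM_sum; apply: le_trans (ler_norm_sum _ _ _) _.
apply: ler_sum => k _; rewrite !coefM; apply: le_trans (ler_norm_sum _ _ _) _.
apply: ler_sum => i _; rewrite normrM !coef_poly.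
have coefE m c : `|if (m < n)%N then m`!%:R^-1 * c ^+ m else 0 : K|
    = if (m < n)%N then m`!%:R^-1 * `|c| ^+ m else 0.
  by case: ifP => _; rewrite ?normr0 // normrM normrX normfV normr_nat.
by rewrite !coefE.
Qed.

End TruncatedExponential.

(** * The complex exponential *)

Section ComplexExponential.
Variable R : realType.
Local Notation C := (Cplx R).

Definition expC (z : C) : C := limn (series (fun k => k`!%:R^-1 * z ^+ k)).

Lemma cvg_expC (z : C) : series (fun k => k`!%:R^-1 * z ^+ k) @ \oo --> expC z.
Proof.
apply: (@cvg_series_dominated _ _ (exp_coeff (complex.Re `|z|))); last first.
  exact: is_cvg_series_exp_coeff.
move=> k; rewrite normrM normfV normr_nat normrX norm_RRe /exp_coeff /= mulrC.
rewrite (rmorphM (real_complex R)) (fmorphV (real_complex R)).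
by rewrite (rmorph_nat (real_complex R)) (rmorphXn (real_complex R)).
Qed.

(** The error made by truncated exponentials is dominated by the same error at
    real arguments, which tends to 0 by the addition formula for the real
    exponential. *)
Lemma expCD (a b : C) : expC (a + b) = expC a * expC b.
Proof.
apply/esym/eqP; rewrite -subr_eq0; apply/eqP.
pose E (z : C) := series (fun k => k`!%:R^-1 * z ^+ k).
pose x := complex.Re `|a|; pose y := complex.Re `|b|.
have E_real (r : R) n : E r%:C n = (series (exp_coeff r) n)%:C.
  rewrite /E /series /= (rmorph_sum (real_complex R)); apply: eq_bigr => k _.
  rewrite (rmorphM (real_complex R)) (fmorphV (real_complex R)) mulrC.
  by rewrite (rmorph_nat (real_complex R)) (rmorphXn (real_complex R)).
have cvgE : (fun n => E a n * E b n - E (a + b) n) @ \oo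
    --> expC a * expC b - expC (a + b).
  by apply: cvgB; [apply: cvgM|]; exact: cvg_expC.
suff cvg0 : (fun n => E a n * E b n - E (a + b) n) @ \oo --> (0 : C).
  exact: (cvg_unique (@norm_hausdorff _ C) cvgE cvg0).
apply/cvgrPdist_lt => _ /pos_RRe[e e0 ->].
have cvgx z : series (exp_coeff z) @ \oo --> expR z.
  exact: is_cvg_series_exp_coeff.
have /cvgrPdist_lt/(_ _ e0) : (fun n => series (exp_coeff x) n
    * series (exp_coeff y) n - series (exp_coeff (x + y)) n) @ \oo --> (0 : R).
  rewrite -[0](subrr (expR (x + y))) [in X in X - _]expRD.
  by apply: cvgB; [apply: cvgM|]; exact: cvgx.
apply: filterS => n; rewrite sub0r normrN => small.
rewrite sub0r normrN; apply: le_lt_trans (exp_series_mul_error n a b) _.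
rewrite (norm_RRe a) (norm_RRe b) -(rmorphD (real_complex R)) -/x -/y.
change (E x%:C n * E y%:C n - E (x + y)%:C n < e%:C); rewrite !E_real.
rewrite -(rmorphM (real_complex R)) -(rmorphB (real_complex R)) ltcR.
exact: le_lt_trans (ler_norm _) small.
Qed.

Lemma expC0 : expC 0 = 1.
Proof.
apply: (cvg_unique _ (@cvg_expC 0)) => //.
apply: cvg_near_cst; exists 1 => // -[//|n] _.
rewrite /series /= big_nat_recl // big1 ?addr0 => [|k _].
  by rewrite fact0 invr1 mul1r.
by rewrite exprS mul0r mulr0.
Qed.

Lemma expC_sum (I : finType) (F : I -> C) :
  expC (\sum_i F i) = \prod_i expC (F i).
Proof. by apply: (big_morph expC); [exact: expCD|exact: expC0]. Qed.

Lemma expCMn (a : C) m : expC (a *+ m) = expC a ^+ m.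
Proof. by elim: m => [|m IH]; rewrite ?expC0 // mulrS exprS expCD IH. Qed.

Lemma expmx_diag n (r : 'rV[C]_n) :
  expmx (diag_mx r) = diag_mx (\row_i expC (r ord0 i)).
Proof.
have powE k i j : (diag_mx r ^+ k) i j = (r ord0 i ^+ k) *+ (i == j).
  elim: k i j => [|k IH] i j; first by rewrite !expr0 mxE.
  rewrite exprS -[LHS]/((diag_mx r *m diag_mx r ^+ k) i j) mul_diag_mx mxE IH.
  by rewrite mulrnAr exprS.
apply/matrixP => i j; apply: (cvg_unique _ (@cvg_expmx_entry _ _ (diag_mx r) i j)) => //.
rewrite [diag_mx (\row_k _) i j]mxE mxE; have [<-|ij] := eqVneq i j.
  rewrite (_ : (fun k => _) = fun k => k`!%:R^-1 * r ord0 i ^+ k).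
    exact: cvg_expC.
  by apply/funext => k; rewrite powE eqxx.
rewrite mulr0n (_ : series _ = fun=> 0); first exact: cvg_cst.
apply/funext => N; rewrite /series /= big1 // => k _.
by rewrite powE (negbTE ij) mulr0.
Qed.

End ComplexExponential.

(** * The symmetric power of a matrix *)

Section SymmetricPower.
Variables (R : realType) (d : nat).
Local Notation C := (Cplx R).
Implicit Types (A B : 'M[C]_d.+1) (m : multinom d.+1).

Definition linform A (i : 'I_d.+1) : mpoly d.+1 C :=
  \sum_j A i j *: mpolyX C (mnm1 j).

(** (ABx)^m is obtained from (Ay)^m by substituting the forms (Bx)_i for the
    variables y_i. *)
Lemma linpow_comp A B m :
  linpow (A *m B) m = comp_mpoly [tuple linform B i | i < d.+1] (linpow A m).
Proof.
rewrite /linpow rmorph_prod /=; apply: eq_bigr => i _.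
rewrite rmorphXn /= raddf_sum /=; congr (_ ^+ _).
under [RHS]eq_bigr do rewrite comp_mpolyZ comp_mpolyXU -tnth_nth tnth_mktuple.
rewrite /linform; under [RHS]eq_bigr do rewrite scaler_sumr.
rewrite exchange_big /=; apply: eq_bigr => j _.
by rewrite mxE scaler_suml; apply: eq_bigr => k _; rewrite scalerA.
Qed.

Lemma sympowM N A B : sympow N (A *m B) = sympow N A *m sympow N B.
Proof.
apply/matrixP => a b; rewrite !mxE linpow_comp [in LHS]sympowP.
rewrite (raddf_sum (comp_mpoly _)) (raddf_sum (mcoeff _)) /=.
rewrite (reindex (@enum_rank _)) /=; last first.
  by exists enum_val => x _; rewrite ?enum_rankK ?enum_valK.
apply: eq_bigr => n _; rewrite comp_mpolyZ mcoeffZ enum_valK !mxE enum_rankK.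
congr (_ * mcoeff _ _).
by rewrite comp_mpolyX; apply: eq_bigr => i _; rewrite tnth_mktuple.
Qed.

Lemma sympow_diag N (r : 'rV[C]_d.+1) :
  sympow N (diag_mx r) =
  diag_mx (\row_a \prod_i r ord0 i ^+ (mindex_val (enum_val a : mindex d N)) i).
Proof.
apply/matrixP => a b; rewrite !mxE.
have -> : linpow (diag_mx r) (mindex_val (enum_val a)) =
  (\prod_i r ord0 i ^+ (mindex_val (enum_val a)) i)
    *: mpolyX C (mindex_val (enum_val a)).
  rewrite mpolyXE_id -scaler_prod; apply: eq_bigr => i _.
  rewrite -exprZn (bigD1 i) //= mxE eqxx big1 ?addr0 // => j ji.
  by rewrite mxE eq_sym (negbTE ji) scale0r.
rewrite mcoeffZ mcoeffX mulr_natr; congr (_ *+ nat_of_bool _).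
apply/eqP/eqP => [ab|->] //; apply: enum_val_inj.
by do 2!apply: val_inj.
Qed.

Lemma sympow1 N : sympow N (1%:M : 'M[C]_d.+1) = 1%:M.
Proof.
rewrite -diag_const_mx sympow_diag -diag_const_mx; congr diag_mx.
by apply/rowP => a; rewrite !mxE big1 // => i _; rewrite mxE expr1n.
Qed.

(** The Leibniz rule: at a point where all the factors take the value 1, no
    cofactor is left in it. *)
Lemma mderiv_meval_prod (v : 'I_d.+1 -> C) (k : 'I_d.+1)
    (F : 'I_d.+1 -> mpoly d.+1 C) m :
  (forall i, meval v (F i) = 1) ->
  meval v (mderiv k (\prod_i F i ^+ m i)) =
  \sum_i meval v (mderiv k (F i)) *+ m i.
Proof.
move=> F1.
suff [] : meval v (\prod_i F i ^+ m i) = 1 /\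
  meval v (mderiv k (\prod_i F i ^+ m i)) =
    \sum_i meval v (mderiv k (F i)) *+ m i by [].
elim/big_rec2: _ => [|i x y _ [y1 y']]; first by rewrite rmorph1 -mpolyC1 mderivC raddf0.
have [p1 p'] : meval v (F i ^+ m i) = 1 /\
  meval v (mderiv k (F i ^+ m i)) = meval v (mderiv k (F i)) *+ m i.
  elim: (m i) => [|e [e1 e']].
    by rewrite expr0 rmorph1 -mpolyC1 mderivC raddf0 mulr0n.
  rewrite exprS mderivM rmorphM raddfD /= !rmorphM /= F1 e1 e' !mulr1 mul1r.
  by rewrite mulrS.
by rewrite mderivM rmorphM raddfD /= !rmorphM /= p1 y1 p' y' mulr1 !mul1r mulr1.
Qed.

(** For j > 0, differentiating in x_j and evaluating at e_0 = (1, 0, ..., 0)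
    extracts, from a homogeneous polynomial of degree N, the coefficient of
    x_0^(N-1) x_j.  This functional is easy to compute on products. *)
Lemma meval_mderiv_monomial N (hN : (0 < N)%N) (j : 'I_d.+1) (n : mindex d N) :
  (0 < j)%N ->
  meval (fun i => (i == ord0)%:R) (mderiv j (mpolyX C (mindex_val n))) =
  (n == row_label hN j)%:R.
Proof.
move=> j0; rewrite mderivX mevalZ mevalX.
have j0' : (ord0 == j) = false by apply/eqP => e; rewrite -e in j0.
have [->|nl] := eqVneq n (row_label hN j).
  rewrite /mindex_val /= big1 => [|i _].
    by rewrite mnmDE mulmnE !mnm1E eqxx j0' mul0n mulr1.
  rewrite mnmBE mnmDE addnK mulmnE mnm1E eq_sym.
  by case: eqP => _; rewrite ?expr1n // mul0n expr0.
have [nj|nj] := posnP (mindex_val n j); first by rewrite nj mul0r.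
(* Otherwise n = (N-1) e_0 + e_j: some exponent other than the one of x_0
   survives the derivation, and makes the monomial vanish at e_0. *)
have [i i0 ni] : exists2 i, i != ord0 & (0 < mnm_sub (mindex_val n) (mnm1 j) i)%N.
  apply: contrapT => noi; case/eqP: nl; do 2!apply: val_inj.
  have n0 i : i != ord0 -> mindex_val n i = mnm1 j i.
    move=> i0; apply/eqP; rewrite eqn_leq; apply/andP; split; last first.
      by rewrite mnm1E; case: eqP => // <-.
    rewrite leqNgt; apply/negP => lt; apply: noi; exists i => //.
    by rewrite mnmBE subn_gt0.
  apply/mnmP => i; change (mindex_val n i = mnm_add (mnm_muln (mnm1 ord0) N.-1) (mnm1 j) i).
  rewrite mnmDE mulmnE mnm1E eq_sym; have [->|i0] := eqVneq i ord0; last first.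
    by rewrite mul0n n0.
  have := mindex_deg n; rewrite mdegE (bigD1 ord0) //=.
  under eq_bigr => k k0 do rewrite n0 //.
  rewrite (bigD1 j) /=; last by rewrite eq_sym j0'.
  rewrite mnm1E eqxx big1 ?addn0 => [e|k /andP[_ kj]]; last first.
    by rewrite mnm1E eq_sym (negbTE kj).
  by rewrite mnm1E eq_sym j0' addn0 mul1n; have := congr1 predn e; rewrite addn1.
by rewrite (bigD1 i) //= (negbTE i0) expr0n -[_ == 0%N]negbK -lt0n ni mul0r mulr0.
Qed.

(** The linear forms (Ax)_i take the value A_i0 = 1 at e_0 and have derivative
    A_ij in x_j there. *)
Lemma sympow_row_label N (hN : (0 < N)%N) A (j : 'I_d.+1) (m : mindex d N) :
  (forall i, A i ord0 = 1) -> (0 < j)%N ->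
  sympow N A (enum_rank m) (enum_rank (row_label hN j)) =
  \sum_i A i j *+ mindex_val m i.
Proof.
move=> A0 j0; pose v (i : 'I_d.+1) : C := (i == ord0)%:R.
transitivity (meval v (mderiv j (linpow A (mindex_val m)))).
  rewrite sympowP (raddf_sum (mderiv j)) (raddf_sum (meval v)) /= (bigD1 (row_label hN j)) //=.
  rewrite mderivZ mevalZ meval_mderiv_monomial // eqxx mulr1.
  rewrite big1 ?addr0 // => n nl.
  by rewrite mderivZ mevalZ (meval_mderiv_monomial hN) // (negbTE nl) mulr0.
rewrite mderiv_meval_prod => [|i].
  apply: eq_bigr => i _; congr (_ *+ _).
  rewrite (raddf_sum (mderiv j)) (raddf_sum (meval v)) /= (bigD1 j) //= mderivZ mevalZ mderivX mnm1E eqxx.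
  rewrite scale1r mevalX big1 => [|k _]; last by rewrite mnmBE subnn expr0.
  rewrite mulr1 big1 ?addr0 // => k kj.
  by rewrite mderivZ mevalZ mderivX mnm1E (negbTE kj) scale0r raddf0 mulr0.
rewrite (raddf_sum (meval v)) /= (bigD1 ord0) //= mevalZ mevalXU /v eqxx mulr1 A0.
rewrite big1 ?addr0 // => k k0.
by rewrite mevalZ mevalXU (negbTE k0) mulr0.
Qed.

End SymmetricPower.

(** * Generators of symmetric powers *)

Section Gamma.
Variables (R : realType) (d N : nat).
Local Notation C := (Cplx R).
Implicit Types (X A : 'M[C]_d.+1) (G : 'M[C]_(mdim d N)).

(** The property that specifies [Gamma N X]. *)
Definition sympow_generator X G :=
  forall t : R, sympow N (expmx (t%:C *: X)) = expmx (t%:C *: G).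

Lemma Gamma_unique X G : sympow_generator X G -> Gamma N X = G.
Proof.
move=> XG; apply: (@xget_unique _ 0 (sympow_generator X)) => // G' XG'.
by apply: expmx_generator_inj => t; rewrite -XG -XG'.
Qed.

Lemma sympow_generator_diag (r : 'rV[C]_d.+1) :
  sympow_generator (diag_mx r)
    (diag_mx (\row_a \sum_i
       r ord0 i *+ (mindex_val (enum_val a : mindex d N)) i)).
Proof.
have scale_diag n (c : C) (s : 'rV[C]_n) : c *: diag_mx s = diag_mx (c *: s).
  by apply/matrixP => i j; rewrite !mxE mulrnAr.
move=> t; rewrite !scale_diag !expmx_diag sympow_diag; congr diag_mx.
apply/rowP => a; rewrite !mxE mulr_sumr expC_sum; apply: eq_bigr => i _.
by rewrite !mxE mulrnAr expCMn.
Qed.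

Lemma sympow_generator_conj A X G : A \in unitmx -> sympow_generator X G ->
  sympow_generator (invmx A *m X *m A)
    (sympow N (invmx A) *m G *m sympow N A).
Proof.
move=> uA XG t.
have scale_conj n (c : C) (V Y U : 'M[C]_n) :
    c *: (V *m Y *m U) = V *m (c *: Y) *m U.
  by rewrite -scalemxAr -scalemxAl.
rewrite !scale_conj !expmx_conj ?mulVmx ?mulmxV //; last 2 first.
- by rewrite -sympowM mulVmx // sympow1.
- by rewrite -sympowM mulmxV // sympow1.
by rewrite !sympowM XG.
Qed.

(** A is a right factor of the invertible matrix diag(D). *)
Lemma Kcondition_unitmx A : Kcondition A -> A \in unitmx.
Proof.
case=> _ [p [D [_ _ D0 ApA]]].
have : diag_mx D \in unitmx.
  rewrite unitmxE det_diag unitfE; apply/prodf_neq0 => i _.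
  by rewrite lt0r_neq0.
by rewrite -ApA unitmx_mul => /andP[].
Qed.

End Gamma.

(** * The intertwining relation and the diagonal of Gamma *)

Unset Implicit Arguments.
Local Close Scope complex_scope.
Local Close Scope classical_set_scope.

Theorem mainTheorem5 (R : realType) (d N : nat) (hN : (0 < N)%N)
    (A : 'M[Cplx R]_d.+1) (hA : Kcondition A) :
  let Lambda (j : 'I_d.+1) : 'M[Cplx R]_d.+1 := diag_mx (\row_i A i j) in
  let X (j : 'I_d.+1) : 'M[Cplx R]_d.+1 := invmx A *m Lambda j *m A in
  let Phi : 'M[Cplx R]_(mdim d N) := (sympow N A)^t* in
  (forall j : 'I_d.+1,
     (Gamma N (X j))^t* *m Phi = Phi *m (Gamma N (Lambda j))^t*) /\
  (forall j : 'I_d.+1, (0 < j)%N ->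
     (Gamma N (Lambda j))^t*
       = diag_mx (row (enum_rank (row_label hN j)) Phi)).
Proof.
move=> Lambda X Phi.
have uA := Kcondition_unitmx hA.
have genL j := @sympow_generator_diag R d N (\row_i A i j).
split=> [j|j j0].
  rewrite (Gamma_unique (sympow_generator_conj uA (genL j))).
  rewrite (Gamma_unique (genL j)) -!map_mxM -!trmx_mul; congr (_^t*).
  by rewrite !mulmxA -sympowM mulmxV // sympow1 mul1mx.
rewrite (Gamma_unique (genL j)); apply/matrixP => a b.
have [A0 _] := hA.
have PhiE : Phi (enum_rank (row_label hN j)) a =
    (\sum_i A i j *+ mindex_val (enum_val a : mindex d N) i)^*.
  by rewrite /Phi mxE mxE -(sympow_row_label hN _ A0 j0) enum_valK.
rewrite [RHS]mxE [row _ _ _ _]mxE PhiE !mxE.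
have [->|ab] := eqVneq a b; last by rewrite !mulr0n conjC0.
by rewrite !mulr1n; congr (_^*); apply: eq_bigr => i _; rewrite mxE.
Qed.
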